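(* Let $R$ be a commutative ring and let $L$ be an $m\times m$ matrix ($m\geq 2$) with entries in $R$, satisfying the following conditions: (1) $f:=\det L$ is a regular element (non-zero-divisor) in $R$; (2) the determinant of some $(m-1)\times(m-1)$ submatrix of $L$ is a regular element over $R/(f)$. Then, for any $2\times 2$ submatrix $T$ of the adjugate matrix $\mathrm{adj}(L)$, $f$ is a factor of $\det T$ in $R$.
   Context: The adjugate $\mathrm{adj}(L)$ of a square matrix $L$ is the transpose of the matrix of signed cofactors of $L$, so $L\,\mathrm{adj}(L)=\mathrm{adj}(L)\,L=(\det L)\,\mathbb{I}_m$. An element $a\in R$ is regular over $R/(f)$ if multiplication by $a$ on $R/(f)$ is injective. *)

(* Defs.v *)
From HB Require Import structures.
From mathcomp Require Import all_boot all_order all_algebra.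
From mathcomp Require Import generic_quotient ring_quotient.
From mathcomp Require Import boolp.

Set Implicit Arguments.
Unset Strict Implicit.
Unset Printing Implicit Defensive.

Import GRing.Theory.
Local Open Scope ring_scope.
Local Open Scope quotient_scope.

(* The ideal (f).  Membership is made boolean classically, so that the
   quotients of [ring_quotient] apply over an arbitrary commutative ring. *)
Definition principal_ideal (R : comPzRingType) (f : R) : {pred R} :=
  fun x => `[< exists y : R, x = f * y >].

Lemma principal_idealP (R : comPzRingType) (f x : R) :
  reflect (exists y : R, x = f * y) (x \in principal_ideal f).
Proof. exact: asboolP. Qed.

Lemma principal_ideal_zmod_closed (R : comPzRingType) (f : R) :
  zmod_closed (principal_ideal f).
Proof.
split=> [|_ _ /principal_idealP[x ->] /principal_idealP[y ->]].
  by apply/principal_idealP; exists 0; rewrite mulr0.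
by apply/principal_idealP; exists (x - y); rewrite mulrBr.
Qed.

HB.instance Definition _ (R : comPzRingType) (f : R) :=
  GRing.isZmodClosed.Build R (principal_ideal f)
    (principal_ideal_zmod_closed f).

Lemma principal_idealMr (R : comPzRingType) (f a x : R) :
  x \in principal_ideal f -> a * x \in principal_ideal f.
Proof.
by move=> /principal_idealP[y ->]; apply/principal_idealP; exists (a * y);
  rewrite mulrCA.
Qed.

(* [ring_quotient] only gives the ring structure on quotients by proper ideals
   of nonzero rings; here f may be a unit, in which case R/(f) is the zero
   ring.  Its additive group is the library's, and its product is the one
   induced by R (see [pi_principal_mul]). *)
Definition principal_quot (R : comPzRingType) (f : R) : Type :=
  {ideal_quot (principal_ideal f)}.

HB.instance Definition _ (R : comPzRingType) (f : R) :=
  GRing.Zmodule.on (principal_quot f).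
HB.instance Definition _ (R : comPzRingType) (f : R) :=
  EqQuotient.on (principal_quot f).

Section PrincipalQuotient.
Variables (R : comPzRingType) (f : R).
Local Notation Q := (principal_quot f).

Lemma pi_principal_eqP (x y : R) :
  reflect (\pi_Q x = \pi_Q y) (x - y \in principal_ideal f).
Proof. by rewrite Quotient.idealrBE; apply: eqP. Qed.

Lemma pi_principal_add (x y : R) : \pi_Q (x + y) = \pi_Q x + \pi_Q y.
Proof. exact: Quotient.pi_add. Qed.

Definition principal_one : Q := \pi_Q 1.
Definition principal_mul (u v : Q) : Q := \pi_Q (repr u * repr v).

Lemma pi_principal_mul (x y : R) :
  \pi_Q (x * y) = principal_mul (\pi_Q x) (\pi_Q y).
Proof.
have piE z : z - repr (\pi_Q z) \in principal_ideal f.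
  by apply/pi_principal_eqP; rewrite reprK.
apply/pi_principal_eqP; set x' := repr (\pi x); set y' := repr (\pi y).
have -> : x * y - x' * y' = y * (x - x') + x' * (y - y').
  by rewrite !mulrBr addrA [y * x]mulrC [y * x']mulrC addrNK.
by apply: rpredD; apply: principal_idealMr; apply: piE.
Qed.

Fact principal_mulA : associative principal_mul.
Proof.
elim/quotW=> x; elim/quotW=> y; elim/quotW=> z.
rewrite -(pi_principal_mul y z) -(pi_principal_mul x (y * z)).
by rewrite -(pi_principal_mul x y) -(pi_principal_mul (x * y) z) mulrA.
Qed.

Fact principal_mulC : commutative principal_mul.
Proof. by move=> u v; rewrite /principal_mul mulrC. Qed.

Fact principal_mul1 : left_id principal_one principal_mul.
Proof. by elim/quotW=> x; rewrite -(pi_principal_mul 1 x) mul1r. Qed.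

Fact principal_mulDl : left_distributive principal_mul +%R.
Proof.
elim/quotW=> x; elim/quotW=> y; elim/quotW=> z.
rewrite -(pi_principal_mul x z) -(pi_principal_mul y z).
rewrite -(pi_principal_add x y) -(pi_principal_mul (x + y) z) mulrDl.
exact: pi_principal_add.
Qed.

HB.instance Definition _ := GRing.Zmodule_isComPzRing.Build Q
  principal_mulA principal_mulC principal_mul1 principal_mulDl.

End PrincipalQuotient.

Definition regular_over_quot (R : comPzRingType) (f a : R) : Prop :=
  GRing.lreg (\pi_(principal_quot f) a).

(* Rows and columns of a submatrix are selected without repetition and kept in
   their original order. *)
Definition is_submatrix (R : Type) (p q m n : nat)
    (T : 'M[R]_(p, q)) (A : 'M[R]_(m, n)) : Prop :=
  exists (r : 'I_p -> 'I_m) (c : 'I_q -> 'I_n),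
    [/\ {homo r : i j / (i < j)%N}, {homo c : i j / (i < j)%N}
      & T = mxsub r c A].

(* Main.v *)
Require Import Defs.
From mathcomp Require Import all_boot all_order all_algebra.

Import GRing.Theory.

(** The divisibility comes from Jacobi's identity for the minors of the adjugate.
    Put [f = \det L] and let [T] be the [k x k] submatrix of [\adj L] on rows [r]
    and columns [c].  In the identity matrix, replace row [c i] by row [r i] of
    [\adj L], for each [i]: the resulting matrix [X] has determinant [\det T].
    Since [\adj L *m L = f%:M], the product [X *m L] is [L] with row [c i]
    replaced by [f] times the [r i]-th unit vector, so pulling [f] out of [k]
    rows gives [\det T * f = f ^+ k * \det Y], where [Y] is [L] with row [c i]
    replaced by the [r i]-th unit vector.  When [f] is regular one factor [f]
    cancels, which leaves [\det T = f ^+ k.-1 * \det Y]; the theorem is the case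
    [k = 2].

    The row replacements are written as updates [A + U *m V] with [U] of width
    [k].  Both [X] and the diagonal matrix that scales the [k] rows by [f] are
    such updates of the identity, so Sylvester's identity [det_add1_mulmx] turns
    their determinants into [k x k] ones, which are read off directly; no
    determinant is expanded. *)

Local Open Scope ring_scope.

(** Sylvester's identity: the two sides are the two Schur complements of the
    block matrix with diagonal blocks [1], [1] and off-diagonal blocks [- U]
    and [V]. *)
Lemma det_add1_mulmx (R : comPzRingType) (m k : nat)
    (U : 'M[R]_(m, k)) (V : 'M[R]_(k, m)) :
  \det (1%:M + U *m V) = \det (1%:M + V *m U).
Proof.
have eqUV : block_mx (1%:M + U *m V) (- U) 0 1%:M *m block_mx 1%:M 0 V 1%:M
    = block_mx 1%:M 0 V 1%:M *m block_mx 1%:M (- U) 0 (1%:M + V *m U).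
  rewrite !mulmx_block !mul1mx !mulmx1 !mul0mx !mulmx0 !mulmxN !mulNmx.
  by rewrite !add0r !addr0 addrK addrCA addNr addr0.
move/(congr1 determinant): eqUV.
by rewrite !det_mulmx !det_ublock !det_lblock !det1 !mulr1 !mul1r.
Qed.

(** Column [i] of [colsub c 1%:M] is the [c i]-th unit vector, so the columns
    are orthonormal when [c] is injective. *)
Lemma rowsub_colsub1 (R : pzRingType) (m k : nat) (c : 'I_k -> 'I_m) :
  injective c -> rowsub c 1%:M *m colsub c 1%:M = 1%:M :> 'M[R]_k.
Proof.
move=> c_inj; rewrite -mxsub_mul mulmx1.
by apply/matrixP=> i j; rewrite !mxE (inj_eq c_inj).
Qed.

(** Jacobi's identity, as the determinant of [X *m L = D *m Y]: left
    multiplication by [colsub c 1%:M] puts row [i] of a matrix in row [c i], so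
    [X] is [1%:M] with its rows [c i] replaced by rows of [\adj L], and [Y] is
    [L] with its rows [c i] replaced by unit vectors. *)
Lemma det_mxsub_adj_mul (R : comPzRingType) (m k : nat) (L : 'M[R]_m)
    (r c : 'I_k -> 'I_m) :
  injective c ->
  \det (mxsub r c (\adj L)) * \det L =
  \det L ^+ k *
    \det (L + colsub c 1%:M *m (rowsub r 1%:M - rowsub c L)).
Proof.
move=> c_inj; set f := \det L; set U := colsub c 1%:M.
set Y := L + _; set UT : 'M[R]_(k, m) := rowsub c 1%:M.
have UTU : UT *m U = 1%:M by apply: rowsub_colsub1.
set X := 1%:M + U *m (rowsub r (\adj L) - UT).
have -> : \det (mxsub r c (\adj L)) = \det X.
  rewrite det_add1_mulmx mulmxBl UTU addrC subrK -mxsub_mul.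
  by rewrite mulmx1.
(* Left multiplication by [D] scales the rows in the image of [c] by [f]. *)
pose D := 1%:M + U *m ((f - 1) *: UT).
have detD : \det D = f ^+ k.
  rewrite det_add1_mulmx -scalemxAl UTU scalemx1 -raddfD /= addrC subrK.
  exact: det_scalar.
rewrite -detD -!det_mulmx; congr (\det _).
have UTL : UT *m L = rowsub c L by rewrite mul_rowsub_mx mul1mx.
have adjL : rowsub r (\adj L) *m L = f *: rowsub r 1%:M.
  rewrite mul_rowsub_mx mul_adj_mx.
  by apply/matrixP=> i j; rewrite !mxE mulr_natr.
have UTY : UT *m Y = rowsub r 1%:M.
  by rewrite [UT *m _]mulmxDr mulmxA UTU mul1mx UTL addrC subrK.
rewrite /X /D !mulmxDl !mul1mx -!mulmxA mulmxBl UTL adjL -scalemxAl UTY.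
rewrite /Y -addrA; congr (L + _); rewrite -mulmxDr; congr (U *m _).
by rewrite scalerBl scale1r [RHS]addrC addrA subrK.
Qed.

Lemma det_mxsub_adj (R : comPzRingType) (m k : nat) (L : 'M[R]_m)
    (r c : 'I_k.+1 -> 'I_m) :
  GRing.lreg (\det L) -> injective c ->
  \det (mxsub r c (\adj L)) =
  \det L ^+ k *
    \det (L + colsub c 1%:M *m (rowsub r 1%:M - rowsub c L)).
Proof.
move=> f_reg c_inj; apply: f_reg.
by rewrite mulrC det_mxsub_adj_mul // exprS mulrA.
Qed.

Theorem theorem1p2 (R : comPzRingType) (m : nat) (hm : (2 <= m)%N)
    (L : 'M[R]_m)
    (hdet : GRing.lreg (\det L))
    (hminor : exists M : 'M[R]_(m.-1),
        is_submatrix M L /\ regular_over_quot (\det L) (\det M)) :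
  forall T : 'M[R]_2, is_submatrix T (\adj L) ->
    exists g : R, \det T = \det L * g.
Proof.
move=> _ [r [c [_ c_incr ->]]].
have c_inj : injective c.
  move=> i j eq_c; apply: val_inj.
  by have [/c_incr|/c_incr|] := ltngtP i j; rewrite ?eq_c ?ltnn.
eexists; exact: (det_mxsub_adj _ _ 1 _ _ _ hdet c_inj).
Qed.
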